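(* Let $\mathcal{C}\subseteq\mathcal{P}([n])$ be a random family in which each subset of $[n]$ is included independently with probability $p=p(n)$. Let $X$ denote the number of sets $\{A,B,C,D\}$ of four distinct members of $\mathcal{C}$ such that $A\cup B=C\cup D$ (so $X=0$ if and only if $\mathcal{C}$ is weakly union-free). Then, as $n\to\infty$, \[ p\ll\left(\tfrac{1}{10}\right)^{n/4}\Rightarrow\mathbb{P}(X=0)\to1,\qquad p\gg\left(\tfrac{1}{10}\right)^{n/4}\Rightarrow\mathbb{P}(X=0)\to0. \]
   Context: $\mathcal{P}([n])$ is the power set of $[n]$. A family $\mathcal{C}\subseteq\mathcal{P}([n])$ is weakly union-free if there are no four distinct $A,B,C,D\in\mathcal{C}$ with $A\cup B=C\cup D$. For nonnegative functions, $f\ll g$ (equivalently $g\gg f$) means $f=o(g)$ as $n\to\infty$. *)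

(* Defs.v *)
From mathcomp Require Import all_boot all_order all_algebra.
From mathcomp Require Import reals.
Set Implicit Arguments.
Unset Strict Implicit.
Unset Printing Implicit Defensive.
Import Order.TTheory GRing.Theory Num.Theory.

Local Open Scope ring_scope.

(* The ground set [n] is 'I_n, and a family of subsets of [n] is an element of
   {set {set 'I_n}}. *)

Definition weakly_union_free (n : nat) (F : {set {set 'I_n}}) : Prop :=
  ~ exists A B C D : {set 'I_n},
      [/\ A \in F, B \in F, C \in F & D \in F] /\
      uniq [:: A; B; C; D] /\ A :|: B = C :|: D.

(* Q = {A, B, C, D} for four distinct sets such that, for some labelling of its
   members, A :|: B = C :|: D. *)
Definition union_quadruple (n : nat) (Q : {set {set 'I_n}}) : bool :=
  [exists A : {set 'I_n}, exists B : {set 'I_n},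
   exists C : {set 'I_n}, exists D : {set 'I_n},
     [&& uniq [:: A; B; C; D], Q == [set A; B; C; D]
       & A :|: B == C :|: D]].

(* Unordered quadruples are counted: each Q contributes 1, however many of its
   labellings satisfy the union equation. *)
Definition num_union_quadruples (n : nat) (F : {set {set 'I_n}}) : nat :=
  #|[set Q : {set {set 'I_n}} | (Q \subset F) && union_quadruple Q]|.

(* The law of the random family: the product, over all A in P([n]), of the
   Bernoulli(p) laws of the events "A belongs to F". *)
Definition family_weight (R : realType) (n : nat) (p : R)
    (F : {set {set 'I_n}}) : R :=
  \prod_(A : {set 'I_n}) (if A \in F then p else 1 - p).

Definition family_prob (R : realType) (n : nat) (p : R)
    (E : pred {set {set 'I_n}}) : R :=
  \sum_(F : {set {set 'I_n}} | E F) family_weight p F.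

(* Sanity check of the law: prescribing membership for the sets in S and
   non-membership for those in T (S, T disjoint) has probability
   p ^ #|S| * (1 - p) ^ #|T|; S = T = set0 gives total mass 1. *)
Lemma family_prob_indep (R : realType) (n : nat) (p : R)
    (S T : {set {set 'I_n}}) : [disjoint S & T] ->
  family_prob p (fun F => (S \subset F) && [disjoint T & F]) =
  p ^+ #|S| * (1 - p) ^+ #|T|.
Proof.
move=> dST; rewrite /family_prob.
pose g (A : {set 'I_n}) (b : bool) : R :=
  if b then (if A \in T then 0 else p) else (if A \in S then 0 else 1 - p).
transitivity (\sum_(F : {set {set 'I_n}}) \prod_A g A (A \in F)).
  rewrite big_mkcond /=; apply: eq_bigr => F _.
  case: ifPn => [/andP[/subsetP SF TF]|].
    apply: eq_bigr => A _; rewrite /g; case: ifPn => AF.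
      by case: ifPn => // AT; rewrite (disjointFr TF AT) in AF.
    by case: ifPn => // AS; rewrite SF in AF.
  rewrite negb_and => /orP[/subsetPn[A AS AF]|].
    by rewrite (bigD1 A) //= /g (negbTE AF) AS mul0r.
  rewrite -setI_eq0 => /set0Pn[A]; rewrite inE => /andP[AT AF].
  by rewrite (bigD1 A) //= /g AF AT mul0r.
rewrite (reindex (fun f : {ffun {set 'I_n} -> bool} => [set A | f A])) /=; last first.
  exists (fun F : {set {set 'I_n}} => [ffun A => A \in F]) => [f _|F _].
    by apply/ffunP => A; rewrite ffunE inE.
  by apply/setP => A; rewrite inE ffunE.
transitivity (\sum_(f : {ffun {set 'I_n} -> bool}) \prod_A g A (f A)).
  by apply: eq_bigr => f _; apply: eq_bigr => A _; rewrite inE.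
rewrite -(bigA_distr_bigA g).
rewrite -!prodr_const [in RHS]big_mkcond [X in _ * X]big_mkcond -big_split /=.
apply: eq_bigr => A _; rewrite big_bool /g.
have [AT|_] := boolP (A \in T); have [AS|_] := boolP (A \in S).
- by rewrite (disjointFr dST AS) in AT.
- by rewrite /= add0r mul1r.
- by rewrite /= addr0 mulr1.
- by rewrite mulr1 /= addrC subrK.
Qed.

(* Main.v *)
Require Import Defs.
From HB Require Import structures.
From mathcomp Require Import all_boot all_order all_algebra.
From mathcomp Require Import all_classical all_reals all_analysis.
From mathcomp Require Import lra ring.
Import Order.TTheory GRing.Theory Num.Theory.
Import numFieldNormedType.Exports.
Local Open Scope classical_set_scope.
Local Open Scope ring_scope.

(** A union quadruple is recorded by the columns (i \in A, i \in B, i \in C,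
    i \in D), i in [n], each of which takes one of 10 values. So there are at
    most 10^n quadruples, and (distinctness failing for at most 6 * 6^n of them)
    at least 10^n / 2 for n >= 5. With x = 10^(-n/4) and r = p / x, the union
    bound gives P(X > 0) <= r^4. For the converse, apply Chebyshev's inequality
    to the number of ordered quadruples, whose mean is at least r^4 / 2. A pair of
    quadruples sharing k >= 1 members does so along one of 208 partial
    matchings of the four positions; for a given matching the number of pairs is at
    most c^n, where c counts the compatible pairs of columns, and in all cases
    c^4 <= 10^(8-k). Such pairs thus contribute at most c^n p^(8-k) <= r^(8-k) to
    the variance, whence P(X = 0) <= 4 * 208 / r. *)

(** * Ordered quadruples as incidence matrices *)

(* A quadruple of subsets of [n], stored as its four-row incidence matrix. *)
Definition quadruple (n : nat) := {ffun 'I_n -> 4.-tuple bool}.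

Definition member {n : nat} (t : quadruple n) (i : nat) : {set 'I_n} :=
  [set x | nth false (t x) i]%SET.

Definition members {n : nat} (t : quadruple n) : seq {set 'I_n} :=
  [seq member t i | i <- iota 0 4].

Definition balanced (u : seq bool) : bool :=
  (nth false u 0 || nth false u 1) == (nth false u 2 || nth false u 3).

Definition union_tuple {n : nat} (t : quadruple n) : bool :=
  [forall x, balanced (t x)] && uniq (members t).

Lemma nth_members n (t : quadruple n) i : (i < 4)%N ->
  nth finset.set0 (members t) i = member t i.
Proof. by move=> i4; rewrite (nth_map 0%N) ?size_iota // nth_iota. Qed.

Lemma balanced_union n (t : quadruple n) :
  [forall x, balanced (t x)] =
  (member t 0 :|: member t 1 == member t 2 :|: member t 3).
Proof.
apply/forallP/eqP => [h|/setP h x].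
  by apply/setP => x; rewrite !inE; apply/eqP/h.
by have := h x; rewrite !inE /balanced => ->.
Qed.

Lemma quadruple_of_sets n (A B C D : {set 'I_n}) :
  exists t : quadruple n, members t = [:: A; B; C; D].
Proof.
exists [ffun x => [tuple x \in A; x \in B; x \in C; x \in D]].
by rewrite /members /=; congr [:: _; _; _; _];
  apply/setP => x; rewrite inE ffunE.
Qed.

Lemma num_union_quadruples_eq0 n (F : {set {set 'I_n}}) :
  num_union_quadruples F = 0%N <-> weakly_union_free F.
Proof.
split.
  move/cards0_eq => h [A [B [C [D [[AF BF CF DF] [ud e]]]]]].
  have : [set A; B; C; D]%SET \in [set Q : {set {set 'I_n}} |
    (Q \subset F) && union_quadruple Q]%SET.
    rewrite inE; apply/andP; split.
      by apply/fintype.subsetP => x; rewrite !inE => /orP[/orP[/orP[]|]|] /eqP ->.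
    apply/existsP; exists A; apply/existsP; exists B.
    apply/existsP; exists C; apply/existsP; exists D.
    by apply/and3P; split => //; apply/eqP.
  by rewrite h inE.
move=> h; apply/eqP; rewrite cards_eq0; apply/eqP/setP => Q.
rewrite !inE; apply/negP => /andP[QF /existsP[A /existsP[B /existsP[C /existsP[D]]]]].
move=> /and3P[ud /eqP QE /eqP e]; apply: h; exists A, B, C, D.
by split => //; split; apply: (fintype.subsetP QF); rewrite QE !inE eqxx ?orbT.
Qed.

Lemma weakly_union_freeP n (F : {set {set 'I_n}}) :
  weakly_union_free F <->
  ~~ [exists t : quadruple n, union_tuple t && all (mem F) (members t)].
Proof.
split=> [h|/existsPn h].
  apply/existsPn => t; apply/negP => /andP[/andP[]]; rewrite balanced_union.
  move=> /eqP e ut /and5P[h0 h1 h2 h3 _]; apply: h.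
  by exists (member t 0), (member t 1), (member t 2), (member t 3).
move=> [A [B [C [D [[AF BF CF DF] [ud e]]]]]].
have [t tE] := quadruple_of_sets n A B C D.
have /negP[] := h t; rewrite /union_tuple tE ud balanced_union /=.
rewrite -!nth_members // tE /= e eqxx /=.
by apply/and5P; split.
Qed.

(** * Counting matrices column by column *)

(** An explicit list of the 16 columns, so that counts over columns reduce by computation. *)
Definition bits4 : seq (seq bool) :=
  [seq a :: s | a <- [:: false; true],
   s <- [seq b :: s | b <- [:: false; true],
   s <- [seq [:: c; d] | c <- [:: false; true], d <- [:: false; true]]]].

Lemma perm_bits4 : perm_eq [seq val u | u : 4.-tuple bool] bits4.
Proof.
apply: uniq_perm => //; first by rewrite map_inj_uniq ?enum_uniq //; apply: val_inj.
move=> s; apply/mapP/idP => [[u _ ->]|].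
  by case: u => [[|[] [|[] [|[] [|[] []]]]]].
move=> sb; have s4 : size s == 4.
  by apply: (allP (_ : all (fun s => size s == 4) bits4)) sb.
by exists (Tuple s4) => //; rewrite mem_enum.
Qed.

Lemma sum_bits4 (f : seq bool -> nat) :
  \sum_(u : 4.-tuple bool) f u = (\sum_(s <- bits4) f s)%N.
Proof.
by rewrite -(perm_big _ perm_bits4) /= big_map /image_mem big_enum.
Qed.

Lemma card_ffun_forall (T : finType) (P : pred T) n :
  #|[pred t : {ffun 'I_n -> T} | [forall x, P (t x)]]| = (#|P| ^ n)%N.
Proof.
rewrite -[n in RHS]card_ord -card_ffun_on; apply: eq_card => t.
by apply/forallP/ffun_onP.
Qed.

(** Zipping two functions into one function of pairs is injective, and a pointwise condition then
    constrains each coordinate independently. *)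
Lemma card_pair_ffun_forall (T : finType) (P : T -> T -> bool) n :
  (#|[pred t : {ffun 'I_n -> T} * {ffun 'I_n -> T} |
     [forall x, P (t.1 x) (t.2 x)]]|
   <= #|[pred u : T * T | P u.1 u.2]| ^ n)%N.
Proof.
rewrite -(card_ffun_forall _ [pred u : T * T | P u.1 u.2] n).
pose g (t : {ffun 'I_n -> T} * {ffun 'I_n -> T}) := [ffun x => (t.1 x, t.2 x)].
have g_inj : injective g.
  move=> [t1 t2] [u1 u2] /ffunP h.
  by congr (_, _); apply/ffunP => x; have := h x; rewrite !ffunE => -[].
rewrite -(card_imset _ g_inj); apply: subset_leq_card.
apply/fintype.subsetP => v /imsetP[t]; rewrite !inE => /forallP h ->.
by apply/forallP => x; rewrite ffunE /=.
Qed.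

(* Position i of the first quadruple is matched with position [nth 4 s i] of the
   second, the value 4 meaning unmatched. *)
Definition agree (s : seq nat) (u v : seq bool) : bool :=
  all (fun i => (nth 4 s i < 4)%N ==>
    (nth false u i == nth false v (nth 4 s i))) (iota 0 4).

Definition matched (s : seq nat) : nat := count (ltn^~ 4) s.
Arguments matched : simpl never.

Definition seqs4 : seq (seq nat) :=
  let r := iota 0 5 in
  [seq a :: s | a <- r, s <- [seq b :: s | b <- r,
   s <- [seq [:: c; d] | c <- r, d <- r]]].

Definition matchings : seq (seq nat) :=
  [seq s <- seqs4 | uniq [seq i <- s | (i < 4)%N] & (0 < matched s)%N].

Definition agree_count (s : seq nat) : nat :=
  count (fun uv => [&& balanced uv.1, balanced uv.2 & agree s uv.1 uv.2])
    [seq (u, v) | u <- bits4, v <- bits4].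

(** Entry [k] is the largest [agree_count] for [k] matched positions. For [k = 1] it is 52 = 6^2 +
    4^2, since a given entry is true in 6 of the 10 balanced columns. The default 0 lies beyond
    [k = 4], which no matching exceeds. *)
Definition agree_bound (k : nat) : nat := nth 0%N [:: 100; 52; 28; 16; 10] k.

Lemma agree_count_le s : s \in matchings ->
  (agree_count s <= agree_bound (matched s))%N.
Proof.
have h : all (fun s => agree_count s <= agree_bound (matched s))%N matchings.
  by vm_compute.
exact: (allP h).
Qed.

(** The nonempty partial injections between two sets of four positions: choosing k positions on each
    side and a bijection gives 16 + 72 + 96 + 24. *)
Lemma size_matchings : size matchings = 208.
Proof. by vm_compute. Qed.

Lemma card_quadruple_forall n (P : pred (seq bool)) :
  #|[pred t : quadruple n | [forall x, P (t x)]]| = (count P bits4 ^ n)%N.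
Proof.
rewrite (card_ffun_forall _ [pred u : 4.-tuple bool | P u] n); congr (_ ^ _)%N.
by rewrite -sum1_card big_mkcond (sum_bits4 (fun u => if P u then 1%N else 0%N))
  -big_mkcond sum1_count.
Qed.

(** * The number of ordered union quadruples *)

Lemma card_balanced n :
  #|[pred t : quadruple n | [forall x, balanced (t x)]]| = (10 ^ n)%N.
Proof. by rewrite card_quadruple_forall. Qed.

Lemma card_has_le (T : finType) (I : Type) (E : I -> pred T) (s : seq I) :
  (#|[pred t | has (E^~ t) s]| <= \sum_(i <- s) #|E i|)%N.
Proof.
elim: s => [|i s ih]; first by rewrite big_nil (eq_card (_ : _ =i pred0)) ?card0.
rewrite big_cons (leq_trans _ (leq_add (leqnn _) ih)) //.
by rewrite -cardUI leq_addr.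
Qed.

Lemma leq_expn2r m n e : (m <= n)%N -> (m ^ e <= n ^ e)%N.
Proof. by case: e => // e mn; rewrite leq_exp2r. Qed.

Definition index_pairs : seq (nat * nat) :=
  [:: (0, 1); (0, 2); (0, 3); (1, 2); (1, 3); (2, 3)]%N.

Lemma has_eq_members n (t : quadruple n) : ~~ uniq (members t) ->
  has (fun ij => member t ij.1 == member t ij.2) index_pairs.
Proof.
rewrite /= !inE !negb_or !negb_and !negbK orbF.
by do 5?case: eqP => //= _.
Qed.

(** At most 6 balanced columns agree at two given positions, so each of the six possible
    coincidences of members costs at most 6^n matrices. *)
Lemma card_union_tuple n :
  (10 ^ n <= #|[pred t : quadruple n | union_tuple t]| + 6 * 6 ^ n)%N.
Proof.
pose E ij := [pred t : quadruple n | [forall x, balanced (t x) &&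
  (nth false (t x) ij.1 == nth false (t x) ij.2)]].
have cardE ij : ij \in index_pairs -> (#|E ij| <= 6 ^ n)%N.
  rewrite (card_quadruple_forall n (fun u => balanced u &&
    (nth false u ij.1 == nth false u ij.2))) => h.
  by apply: leq_expn2r; move: ij h; apply/allP; vm_compute.
rewrite -card_balanced -(cardID [pred t : quadruple n | uniq (members t)]).
apply: leq_add.
  by apply: subset_leq_card; apply/fintype.subsetP => t; rewrite !inE andbC.
apply: (@leq_trans (\sum_(ij <- index_pairs) #|E ij|)%N); last first.
  by rewrite big_seq (leq_trans (leq_sum _ cardE)) // -big_seq big_const_seq
    iter_addn_0 mulnC.
rewrite (leq_trans _ (card_has_le _ _ _ _)) //; apply: subset_leq_card.
apply/fintype.subsetP => t; rewrite !inE => /andP[/has_eq_members /hasP[ij ijP e]].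
move=> /forallP tb; apply/hasP; exists ij => //; apply/forallP => x; rewrite tb /=.
by move/eqP/setP/(_ x): e; rewrite !inE => ->.
Qed.

(** * Pairs of quadruples with common members *)

Lemma card_agree n s :
  (#|[pred tt : quadruple n * quadruple n |
      [forall x, [&& balanced (tt.1 x), balanced (tt.2 x) & agree s (tt.1 x) (tt.2 x)]]]|
   <= agree_count s ^ n)%N.
Proof.
apply: leq_trans (card_pair_ffun_forall _ (fun u v : 4.-tuple bool =>
  [&& balanced u, balanced v & agree s u v]) n) _.
apply: leq_expn2r; rewrite -sum1_card big_mkcond.
pose g (u v : seq bool) := if [&& balanced u, balanced v & agree s u v] then 1%N else 0%N.
rewrite -(pair_bigA _ (fun u v : 4.-tuple bool => g u v)) /=.
rewrite (eq_bigr (fun u : 4.-tuple bool => \sum_(v <- bits4) g u v)%N) => [|u _];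
  last by rewrite sum_bits4.
rewrite (sum_bits4 (fun u => \sum_(v <- bits4) g u v)%N) /g.
by rewrite /agree_count -sum1_count [in leqRHS]big_mkcond big_allpairs.
Qed.

(** For a set that is not a member of [t'], [index] returns the length 4, which is exactly the
    unmatched value. *)
Definition matching {n : nat} (t t' : quadruple n) : seq nat :=
  [seq index A (members t') | A <- members t].
Arguments matching : simpl never.

Lemma mem_seqs4 s : size s = 4 -> all (fun i => i < 5)%N s -> s \in seqs4.
Proof.
case: s => [|a [|b [|c [|d []]]]] //= _ /and5P[a5 b5 c5 d5 _].
by rewrite /seqs4 !allpairs_f // mem_iota.
Qed.

(** An entry below 4 determines the member of [t] through [nth], so distinct members of [t] have
    distinct matched entries. *)
Lemma matching_in n (t t' : quadruple n) :
  uniq (members t) -> (0 < matched (matching t t'))%N ->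
  matching t t' \in matchings.
Proof.
move=> ut m0; rewrite mem_filter m0 andbT mem_seqs4 ?size_map ?size_iota //.
  rewrite andbT filter_map map_inj_in_uniq ?filter_uniq // => A B.
  rewrite !mem_filter => /andP[A4 _] /andP[B4 _] e.
  have i4 C : (index C (members t') < 4)%N -> C \in members t'.
    by rewrite -index_mem size_map.
  by rewrite -(nth_index finset.set0 (i4 _ A4)) e nth_index ?i4.
by apply/allP => _ /mapP[A _ ->]; rewrite ltnS (leq_trans (index_size _ _)) // size_map.
Qed.

Lemma matching_agree n (t t' : quadruple n) x : agree (matching t t') (t x) (t' x).
Proof.
apply/allP => i; rewrite mem_iota /= add0n => i4.
rewrite (nth_map finset.set0) ?size_map ?size_iota // nth_members //.
apply/implyP => j4.
have /setP/(_ x) : member t' (index (member t i) (members t')) = member t i.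
  by rewrite -nth_members // nth_index // -index_mem size_map.
by rewrite !inE => ->.
Qed.

Definition member_set {n : nat} (t : quadruple n) : {set {set 'I_n}} :=
  [set A in members t]%SET.

Lemma card_member_set n (t : quadruple n) : uniq (members t) ->
  #|member_set t| = 4.
Proof. by move=> ut; rewrite cardsE; move/card_uniqP: ut => ->. Qed.

Lemma card_member_setU n (t t' : quadruple n) :
  uniq (members t) -> uniq (members t') ->
  #|member_set t :|: member_set t'| = (8 - matched (matching t t'))%N.
Proof.
move=> ut ut'; rewrite cardsU !card_member_set //; congr (_ - _)%N.
rewrite (_ : member_set t :&: member_set t' =
    [set A in [seq A <- members t | A \in members t']]%SET); last first.
  by apply/setP => A; rewrite finset.in_setI !finset.in_set mem_filter andbC.
rewrite cardsE; move/card_uniqP: (filter_uniq (mem (members t')) ut) => ->.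
rewrite size_filter /matched /matching count_map; apply: eq_count => A.
have -> : mem (members t') A = (A \in members t') by [].
by rewrite -index_mem size_map.
Qed.

(** The numerical core: 52^4 < 10^7, 28^4 < 10^6 and 16^4 < 10^5, with equality for [k = 0] and
    [k = 4]; beyond 4 the left side is 0. *)
Lemma agree_bound_expr4 (R : realType) k :
  (agree_bound k)%:R ^+ 4 <= 10%:R ^+ (8 - k) :> R.
Proof.
case: k => [|[|[|[|[|k]]]]]; rewrite /agree_bound /= ?subSS ?subn0 ?[(8 - 0)%N]/=;
  try by rewrite !exprS expr0; lra.
by rewrite nth_nil expr0n /= exprn_ge0.
Qed.

(** * First and second moments of the labelled count *)

Lemma family_weight_ge0 (R : realType) n (p : R) (F : {set {set 'I_n}}) :
  0 <= p <= 1 -> 0 <= family_weight p F.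
Proof.
by move=> /andP[p0 p1]; apply: prodr_ge0 => A _; case: ifP; rewrite ?subr_ge0.
Qed.

Lemma family_prob_subset (R : realType) n (p : R) (S : {set {set 'I_n}}) :
  family_prob p (fun F => S \subset F) = p ^+ #|S|.
Proof.
have := @family_prob_indep R n p S finset.set0.
rewrite cards0 expr0 mulr1 -setI_eq0 finset.setI0 => <- //.
by apply: eq_bigl => F; rewrite -setI_eq0 finset.set0I eqxx andbT.
Qed.

Lemma sum_family_weight (R : realType) n (p : R) :
  \sum_(F : {set {set 'I_n}}) family_weight p F = 1.
Proof.
rewrite -[RHS](expr0 p) -(@cards0 {set 'I_n}) -family_prob_subset.
by apply: eq_bigl => F; rewrite finset.sub0set.
Qed.

Lemma sum_family_weight_subset (R : realType) n (p : R) (S : {set {set 'I_n}}) :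
  \sum_(F : {set {set 'I_n}}) family_weight p F * (S \subset F)%:R = p ^+ #|S|.
Proof.
rewrite -family_prob_subset /family_prob [in RHS]big_mkcond.
by apply: eq_bigr => F _; case: ifP; rewrite ?mulr1 ?mulr0.
Qed.

(** Chebyshev's inequality without division: where [Y] vanishes, the squared deviation is [m ^+ 2],
    and the other terms of the variance are nonnegative. *)
Lemma chebyshev_eq0 (R : realFieldType) (T : finType) (w Y : T -> R) (m : R) :
  (forall i, 0 <= w i) -> \sum_i w i = 1 -> \sum_i w i * Y i = m ->
  (\sum_(i | Y i == 0) w i) * m ^+ 2 <= \sum_i w i * Y i ^+ 2 - m ^+ 2.
Proof.
move=> w0 w1 wY.
have -> : \sum_i w i * Y i ^+ 2 - m ^+ 2 = \sum_i w i * (Y i - m) ^+ 2.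
  under [RHS]eq_bigr => i _.
    rewrite (_ : _ * _ = w i * Y i ^+ 2 - (m *+ 2) * (w i * Y i) + m ^+ 2 * w i);
      last by ring.
    over.
  rewrite big_split sumrB -!mulr_sumr w1 wY /=.
  ring.
rewrite mulr_suml [leRHS](bigID (fun i => Y i == 0)) /= -[leLHS]addr0.
apply: lerD; last by apply: sumr_ge0 => i _; rewrite mulr_ge0 ?sqr_ge0.
by apply: ler_sum => i /eqP ->; rewrite sub0r sqrrN.
Qed.

(** Each unordered quadruple is counted once per valid labelling. This count vanishes exactly when X
    does, which suffices for P(X = 0). *)
Definition tuple_count (R : realType) {n : nat} (F : {set {set 'I_n}}) : R :=
  \sum_(t : quadruple n | union_tuple t) (member_set t \subset F)%:R.

Lemma tuple_count_eq0 (R : realType) n (F : {set {set 'I_n}}) :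
  (num_union_quadruples F == 0%N) = (tuple_count R F == 0).
Proof.
apply/eqP/eqP => [/num_union_quadruples_eq0/weakly_union_freeP/existsPn h|h].
  apply: big1 => t ut; case: (boolP (_ \subset _)) => // /fintype.subsetP tF.
  have /negP[] := h t; rewrite ut; apply/allP => A At; apply: tF.
  by rewrite finset.in_set.
apply/num_union_quadruples_eq0/weakly_union_freeP/existsPn => t.
apply/negP => /andP[ut /allP tF].
have := psumr_eq0P (fun (t : quadruple n) _ => ler0n R (member_set t \subset F)) h ut.
case: (boolP (_ \subset _)) => [_ /eqP|/fintype.subsetP[] A]; first by rewrite oner_eq0.
by rewrite finset.in_set; apply: tF.
Qed.

Lemma tuple_count_mean (R : realType) n (p : R) :
  \sum_(F : {set {set 'I_n}}) family_weight p F * tuple_count R F =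
  #|[pred t : quadruple n | union_tuple t]|%:R * p ^+ 4.
Proof.
under eq_bigr do rewrite /tuple_count mulr_sumr.
rewrite exchange_big /=.
under eq_bigr => t ut do
  rewrite sum_family_weight_subset card_member_set ?(andP ut).2 //.
by rewrite sumr_const mulr_natl.
Qed.

(** A product of two inclusion indicators is the indicator for the union of the member sets, whose
    size is 8 minus the overlap. *)
Lemma tuple_count_mean2 (R : realType) n (p : R) :
  \sum_(F : {set {set 'I_n}}) family_weight p F * tuple_count R F ^+ 2 =
  \sum_(t : quadruple n | union_tuple t) \sum_(t' : quadruple n | union_tuple t')
    p ^+ (8 - matched (matching t t')).
Proof.
transitivity (\sum_(F : {set {set 'I_n}}) \sum_(t : quadruple n | union_tuple t)
  \sum_(t' : quadruple n | union_tuple t')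
    family_weight p F * (member_set t :|: member_set t' \subset F)%:R).
  apply: eq_bigr => F _; rewrite /tuple_count expr2 big_distrlr /= mulr_sumr.
  apply: eq_bigr => t _; rewrite mulr_sumr; apply: eq_bigr => t' _.
  by rewrite finset.subUset -natrM mulnb.
rewrite exchange_big; apply: eq_bigr => t ut.
rewrite exchange_big; apply: eq_bigr => t' ut'.
by rewrite sum_family_weight_subset card_member_setU ?(andP ut).2 ?(andP ut').2.
Qed.

Lemma ler_mem_sum (R : numDomainType) (I : eqType) (r : seq I) (f : I -> R) i :
  i \in r -> (forall j, 0 <= f j) -> f i <= \sum_(j <- r) f j.
Proof. by move=> ir f0; rewrite (big_rem _ ir) /= lerDl sumr_ge0. Qed.

(** Pairs with no common member contribute p^8 to both terms and cancel. Any other pair is charged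
    to its own matching, and its subtracted p^8 is dropped. *)
Lemma tuple_count_variance (R : realType) n (p : R) : 0 <= p ->
  \sum_(F : {set {set 'I_n}}) family_weight p F * tuple_count R F ^+ 2
    - (#|[pred t : quadruple n | union_tuple t]|%:R * p ^+ 4) ^+ 2
  <= \sum_(s <- matchings) (agree_count s ^ n)%:R * p ^+ (8 - matched s).
Proof.
move=> p0.
pose G s (tt : quadruple n * quadruple n) := [forall x,
  [&& balanced (tt.1 x), balanced (tt.2 x) & agree s (tt.1 x) (tt.2 x)]].
apply: (@le_trans _ _
  (\sum_(s <- matchings) \sum_(tt | G s tt) p ^+ (8 - matched s))); last first.
  apply: ler_sum => s _; rewrite sumr_const -[leLHS]mulr_natl.
  by apply: ler_wpM2r; rewrite ?exprn_ge0 // ler_nat; apply: card_agree.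
rewrite tuple_count_mean2 pair_big /=.
have -> : (#|[pred t : quadruple n | union_tuple t]|%:R * p ^+ 4) ^+ 2 =
    \sum_(tt : quadruple n * quadruple n | union_tuple tt.1 && union_tuple tt.2) p ^+ 8.
  rewrite -(pair_big (fun t : quadruple n => union_tuple t)
    (fun t : quadruple n => union_tuple t) (fun _ _ => p ^+ 8)) /=.
  by rewrite !sumr_const -mulrnA -[RHS]mulr_natl natrM; ring.
rewrite -sumrB.
under [leRHS]eq_bigr do rewrite big_mkcond.
rewrite exchange_big big_mkcond /=; apply: ler_sum => -[t t'] _ /=.
have G0 s : 0 <= (if G s (t, t') then p ^+ (8 - matched s) else 0).
  by case: ifP => // _; rewrite exprn_ge0.
case: ifP => [/andP[/andP[/forallP bt ut] /andP[/forallP bt' ut']]|_]; last exact: sumr_ge0.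
have [m0|] := posnP (matched (matching t t')).
  by rewrite m0 subn0 subrr sumr_ge0.
move=> /(matching_in _ _ _ ut) sM.
have := ler_mem_sum _ _ _ _ _ sM G0; rewrite ifT; last first.
  by apply/forallP => x; rewrite bt bt' matching_agree.
by apply: le_trans; rewrite gerBl exprn_ge0.
Qed.

(** * Bounds on P(X = 0) in terms of p / x *)

(** Compare fourth powers: c^4 <= 10^(8-k) and x^4 = 10^(-n) make the powers of 10 cancel. *)
Lemma agree_count_scaled (R : realType) n (x : R) s :
  0 <= x -> x ^+ 4 * 10%:R ^+ n = 1 -> s \in matchings ->
  (agree_count s ^ n)%:R * x ^+ (8 - matched s) <= 1.
Proof.
move=> x0 x4 sM; rewrite -(@expr_le1 _ 4) ?mulr_ge0 ?exprn_ge0 //.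
rewrite exprMn natrX exprAC -[x ^+ _ ^+ 4]exprAC.
apply: (@le_trans _ _ ((10%:R ^+ (8 - matched s)) ^+ n * x ^+ 4 ^+ (8 - matched s))).
  apply: ler_wpM2r; first by rewrite !exprn_ge0.
  rewrite lerXn2r ?nnegrE ?exprn_ge0 //.
  apply: le_trans (agree_bound_expr4 _ _).
  by rewrite lerXn2r ?nnegrE // ler_nat agree_count_le.
by rewrite exprAC -exprMn mulrC x4 expr1n.
Qed.

Lemma card_union_tuple_half (R : realType) n : (5 <= n)%N ->
  10%:R ^+ n <= 2 * #|[pred t : quadruple n | union_tuple t]|%:R :> R.
Proof.
move=> n5; have := card_union_tuple n.
rewrite -(ler_nat R) natrD natrM !natrX.
(* This is where [5 <= n] enters: 12 * 6^5 = 93312 < 10^5, whereas the inequality fails at n = 4. *)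
suff : 12%:R * 6%:R ^+ n <= 10%:R ^+ n :> R by lra.
rewrite -(subnKC n5) !exprD mulrA ler_pM ?exprn_ge0 ?mulr_ge0 //.
  by rewrite !exprS expr0; lra.
by rewrite lerXn2r ?nnegrE // ler_nat.
Qed.

Lemma family_prob_ge0 (R : realType) n (p : R) (E : pred {set {set 'I_n}}) :
  0 <= p <= 1 -> 0 <= family_prob p E.
Proof. by move=> p01; apply: sumr_ge0 => F _; apply: family_weight_ge0. Qed.

Lemma family_prob_ub (R : realType) n (p x : R) : (5 <= n)%N ->
  0 <= p <= 1 -> 0 < x -> x ^+ 4 * 10%:R ^+ n = 1 -> x <= p ->
  family_prob p (fun F : {set {set 'I_n}} => num_union_quadruples F == 0%N)
  <= 832%:R * (x / p).
Proof.
move=> n5 p01 x0 x4 xp.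
have p0 : 0 < p by apply: lt_le_trans xp.
set P := family_prob _ _.
have := chebyshev_eq0 _ _ _ _ _ (fun F => family_weight_ge0 R n p F p01)
  (sum_family_weight R n p) (tuple_count_mean R n p).
rewrite (eq_bigl (fun F : {set {set 'I_n}} => num_union_quadruples F == 0%N));
  last by move=> F; rewrite (tuple_count_eq0 R).
rewrite -/(family_prob _ _) -/P.
move=> /le_trans/(_ (tuple_count_variance R n p (ltW p0))).
set N : R := #|_|%:R => cheb.
pose r := p / x.
have r1 : 1 <= r by rewrite ler_pdivlMr ?mul1r.
have r0 : 0 < r by apply: lt_le_trans r1.
have pE : p = r * x by rewrite divfK ?gt_eqF.
have xp' : x / p = r^-1 by rewrite /r invf_div.
clearbody r.
have var : \sum_(s <- matchings) (agree_count s ^ n)%:R * p ^+ (8 - matched s)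
    <= 208%:R * r ^+ 7.
  apply: (@le_trans _ _ (\sum_(s <- matchings) r ^+ 7)); last first.
    by rewrite big_const_seq count_predT size_matchings iter_addr_0 mulr_natl.
  rewrite big_seq [leRHS]big_seq; apply: ler_sum => s sM.
  rewrite pE exprMn mulrCA -[leRHS]mulr1.
  apply: ler_pM; rewrite ?mulr_ge0 ?exprn_ge0 ?(ltW r0) ?(ltW x0) //.
    (* At least one position is matched, so the exponent 8 - k is at most 7, and r >= 1. *)
    apply: ler_weXn2l => //; move: sM; rewrite mem_filter => /andP[/andP[_ m0] _].
    by rewrite leq_subLR -[8%N]/(1 + 7)%N leq_add2r.
  by apply: agree_count_scaled x4 sM; apply: ltW.
have mean : r ^+ 4 <= 2 * (N * p ^+ 4).
  have -> : r ^+ 4 = 10%:R ^+ n * p ^+ 4.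
    by rewrite pE exprMn [RHS]mulrCA [in RHS](mulrC (_ ^+ n)) x4 mulr1.
  by rewrite mulrA ler_wpM2r ?exprn_ge0 ?(ltW p0) // card_union_tuple_half.
have P0 : 0 <= P by apply: family_prob_ge0.
have mean2 : r ^+ 8 <= 4 * (N * p ^+ 4) ^+ 2.
  rewrite (_ : r ^+ 8 = r ^+ 4 ^+ 2); last by rewrite -exprM.
  rewrite (_ : 4 * _ = (2 * (N * p ^+ 4)) ^+ 2); last by ring.
  by rewrite lerXn2r ?nnegrE ?mulr_ge0 ?exprn_ge0 ?(ltW r0) ?(ltW p0).
(* Clearing denominators leaves P r^8 <= 832 r^7, where 832 = 4 * 208 combines the squared mean with
   the number of matchings. *)
rewrite xp' ler_pdivlMr // -(ler_pM2r (exprn_gt0 7 r0)) -mulrA -exprS.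
apply: (@le_trans _ _ (P * (4 * (N * p ^+ 4) ^+ 2))); first exact: ler_wpM2l.
by move: cheb var; lra.
Qed.

(** Markov's inequality: X > 0 makes the integer [tuple_count] at least 1, so P(X > 0) is at most
    its mean, itself at most 10^n p^4 = (p / x)^4. *)
Lemma family_prob_lb (R : realType) n (p x : R) :
  0 <= p <= 1 -> 0 < x -> x ^+ 4 * 10%:R ^+ n = 1 ->
  1 - (p / x) ^+ 4 <=
  family_prob p (fun F : {set {set 'I_n}} => num_union_quadruples F == 0%N) <= 1.
Proof.
move=> p01 x0 x4; have p0 : 0 <= p by case/andP: p01.
have := sum_family_weight R n p.
rewrite (bigID (fun F : {set {set 'I_n}} => num_union_quadruples F == 0%N)) /=.
rewrite -/(family_prob _ _); set P := family_prob _ _; set Q := \sum_(F | _) _ => PQ.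
have Q0 : 0 <= Q by apply: sumr_ge0 => F _; apply: family_weight_ge0.
have Qle : Q <= (p / x) ^+ 4.
  have -> : (p / x) ^+ 4 = 10%:R ^+ n * p ^+ 4.
    have x40 : x ^+ 4 != 0 by rewrite expf_neq0 ?gt_eqF.
    have -> : 10%:R ^+ n = (x ^+ 4)^-1 by apply: (mulfI x40); rewrite x4 mulfV.
    by rewrite expr_div_n mulrC.
  apply: (@le_trans _ _ (#|[pred t : quadruple n | union_tuple t]|%:R * p ^+ 4)).
    rewrite -tuple_count_mean /Q big_mkcond; apply: ler_sum => F _.
    have Y0 : 0 <= tuple_count R F by apply: sumr_ge0.
    case: ifPn => h; last by rewrite mulr_ge0 ?family_weight_ge0.
    rewrite ler_peMr ?family_weight_ge0 // /tuple_count -natr_sum.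
    move: h; rewrite (tuple_count_eq0 R) /tuple_count -natr_sum pnatr_eq0 -lt0n.
    by rewrite ler1n.
  rewrite ler_wpM2r ?exprn_ge0 // -natrX ler_nat -card_balanced.
  by apply: subset_leq_card; apply/fintype.subsetP => t /andP[].
by apply/andP; split; move: PQ Q0 Qle; lra.
Qed.

(** * The threshold theorem *)

Lemma threshold_expr4 (R : realType) n :
  ((10%:R^-1 : R) `^ (n%:R / 4%:R)) ^+ 4 * 10%:R ^+ n = 1.
Proof.
rewrite -powR_mulrn ?powR_ge0 // -powRrM divfK ?pnatr_eq0 // powR_mulrn ?invr_ge0 //.
by rewrite exprVn mulVf // expf_neq0 // pnatr_eq0.
Qed.

Theorem theorem5p1 (R : realType) (p : nat -> R)
    (hp : forall n : nat, 0 <= p n <= 1) :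
  (forall (n : nat) (F : {set {set 'I_n}}),
      num_union_quadruples F = 0%N <-> weakly_union_free F) /\
  ((p =o_\oo (fun n : nat => (10%:R^-1 : R) `^ (n%:R / 4%:R))) ->
     (fun n : nat => family_prob (p n)
        (fun F : {set {set 'I_n}} => num_union_quadruples F == 0%N))
       @ \oo --> (1 : R)) /\
  (((fun n : nat => (10%:R^-1 : R) `^ (n%:R / 4%:R)) =o_\oo p) ->
     (fun n : nat => family_prob (p n)
        (fun F : {set {set 'I_n}} => num_union_quadruples F == 0%N))
       @ \oo --> (0 : R)).
Proof.
split; first exact: num_union_quadruples_eq0.
have x0 n : 0 < (10%:R^-1 : R) `^ (n%:R / 4%:R) by rewrite powR_gt0 // invr_gt0.
split=> /eqoP small; apply/cvgrPdist_le => e e0.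
(* With r = p / x, the bound r <= 1 gives r^4 <= r, and then r <= e finishes. *)
- have d0 : 0 < Num.min 1 e by rewrite lt_min ltr01.
  near=> n.
  have : `|p n| <= Num.min 1 e * `|(10%:R^-1 : R) `^ (n%:R / 4%:R)|.
    by near: n; apply: small.
  have /andP[p0 _] := hp n.
  rewrite ger0_norm // gtr0_norm // -ler_pdivrMr // le_min => /andP[r1 re].
  have r0 : 0 <= p n / (10%:R^-1 : R) `^ (n%:R / 4%:R) by rewrite divr_ge0 // ltW.
  have /andP[lb ub] := family_prob_lb R n (p n) _ (hp n) (x0 n) (threshold_expr4 R n).
  rewrite ger0_norm ?subr_ge0 // lerBlDl (le_trans _ (lerD lb re)) //.
  by rewrite -addrA lerDl addrC subr_ge0 exprS ler_piMr // exprn_ile1.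
(* The 1 yields x <= p, required by [family_prob_ub]; the other term absorbs its constant. *)
- have d0 : 0 < Num.min 1 (e / 832%:R) by rewrite lt_min ltr01 divr_gt0 ?ltr0n.
  near=> n.
  have : `|(10%:R^-1 : R) `^ (n%:R / 4%:R)| <= Num.min 1 (e / 832%:R) * `|p n|.
    by near: n; apply: small.
  have /andP[p0 _] := hp n.
  rewrite gtr0_norm // (ger0_norm p0) => xp.
  have pn0 : 0 < p n by rewrite -(pmulr_rgt0 _ d0) (lt_le_trans _ xp).
  move: xp; rewrite -ler_pdivrMr // le_min => /andP[].
  rewrite ler_pdivrMr // mul1r => xp xpe.
  have n5 : (5 <= n)%N by near: n; apply: nbhs_infty_ge.
  rewrite sub0r normrN ger0_norm ?family_prob_ge0 //.
  apply: le_trans (family_prob_ub R n (p n) _ n5 (hp n) (x0 n) (threshold_expr4 R n) xp) _.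
  by move: xpe; rewrite ler_pdivlMr ?ltr0n // [_ * 832%:R]mulrC.
Unshelve. all: by end_near.
Qed.
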